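(* Let $(X,\tilde X)$ and $(Y,\tilde Y)$ be two random vectors with diagonal sections $\delta_1$ and $\delta_2$, respectively. Suppose that $X=_{st}\tilde X$ and $Y=_{st}\tilde Y$. If $Y\le_d X$ and $\delta_1\le\delta_2$, then $$\mathsf{GMD}(X,\tilde X)\ge \mathsf{GMD}(Y,\tilde Y).$$
   Context: Standing assumptions: all random variables are nonnegative with mean in $(0,\infty)$; components of a vector may be dependent. $=_{st}$ denotes equality in law. The diagonal section of a random vector with copula $C$ (i.e. joint distribution function $C$ composed with the marginal distribution functions) is $\delta(u)=C(u,u)$, $u\in[0,1]$; $\delta_1\le\delta_2$ means $\delta_1(u)\le\delta_2(u)$ for all $u\in[0,1]$. For a random variable $Z$ with cumulative distribution function $F_Z$, the quantile function is $F_Z^{-1}(u)=\sup\{x: F_Z(x)\le u\}$. The dispersive order $Y\le_d X$ means $F_Y^{-1}(v)-F_Y^{-1}(u)\le F_X^{-1}(v)-F_X^{-1}(u)$ whenever $0<u\le v<1$. The bivariate Gini's mean difference is $\mathsf{GMD}(X,Y)=\mathsf{E}|X-Y|$. *)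

(* Defs.v *)
From HB Require Import structures.
From mathcomp Require Import all_boot all_order all_algebra.
From mathcomp Require Import all_classical all_reals all_analysis.
Import Order.TTheory GRing.Theory Num.Theory.
Import numFieldNormedType.Exports.

Set Implicit Arguments.
Unset Strict Implicit.
Unset Printing Implicit Defensive.

Local Open Scope classical_set_scope.
Local Open Scope ring_scope.

(* Only the restriction of C to the unit square is meaningful. *)
Record is_copula (R : realType) (C : R -> R -> R) : Prop := IsCopula {
  copula0l : forall v, 0 <= v <= 1 -> C 0 v = 0;
  copula0r : forall u, 0 <= u <= 1 -> C u 0 = 0;
  copula1l : forall v, 0 <= v <= 1 -> C 1 v = v;
  copula1r : forall u, 0 <= u <= 1 -> C u 1 = u;
  copula_2incr : forall u1 u2 v1 v2,
    0 <= u1 -> u1 <= u2 -> u2 <= 1 -> 0 <= v1 -> v1 <= v2 -> v2 <= 1 ->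
    0 <= C u2 v2 - C u2 v1 - C u1 v2 + C u1 v1 }.

Definition diagonal_section (R : realType) (C : R -> R -> R) : R -> R :=
  fun u => C u u.

Definition le01 (R : realType) (f g : R -> R) : Prop :=
  forall u, 0 <= u <= 1 -> f u <= g u.

Section OneSpace.
Context d (T : measurableType d) (R : realType) (P : probability T R).

(* Without continuity of the marginals, a vector may have several copulas; they
   all agree on the product of the ranges of the marginal cdfs. *)
Definition has_copula (X Y : {RV P >-> R}) (C : R -> R -> R) : Prop :=
  is_copula C /\
  forall x y : R,
    P [set w | X w <= x /\ Y w <= y] =
    (C (fine (cdf X x)) (fine (cdf Y y)))%:E.

(* For 0 < u < 1 the set below is nonempty and bounded above; elsewhere the
   value of sup may be arbitrary. *)
Definition quantile (X : {RV P >-> R}) (u : R) : R :=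
  sup [set x : R | (cdf X x <= u%:E)%E].

Definition nonneg_finite_mean (X : {RV P >-> R}) : Prop :=
  {ae P, forall w, 0 <= X w} /\ (0 < 'E_P[X] < +oo)%E.

Definition GMD (X Y : {RV P >-> R}) : \bar R :=
  'E_P[fun w => (`|X w - Y w|)%R]%E.

End OneSpace.

Section TwoSpaces.
Context d1 (T1 : measurableType d1) d2 (T2 : measurableType d2) (R : realType).
Context (P : probability T1 R) (Q : probability T2 R).

(* The values of a measure on non-measurable sets are irrelevant, hence no
   plain equality of the two distributions. *)
Definition eq_law (X : {RV P >-> R}) (Y : {RV Q >-> R}) : Prop :=
  forall A : set R, measurable A -> distribution P X A = distribution Q Y A.

Definition dispersive_le (Y : {RV Q >-> R}) (X : {RV P >-> R}) : Prop :=
  forall u v : R, 0 < u -> u <= v -> v < 1 ->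
    quantile Y v - quantile Y u <= quantile X v - quantile X u.

End TwoSpaces.

(* Main.v *)
Require Import Defs.
From HB Require Import structures.
From mathcomp Require Import all_boot all_order all_algebra.
From mathcomp Require Import all_classical all_reals all_analysis.
From mathcomp Require Import lra measurable_realfun.
Import Order.TTheory GRing.Theory Num.Theory.
Import numFieldNormedType.Exports.

Set Implicit Arguments.
Unset Strict Implicit.
Unset Printing Implicit Defensive.

Local Open Scope ring_scope.

(** Write F for the common distribution function of X and Xt, and put
    h1 u = 2 (u - delta1 u).  Since |x - y| is the length of the set of the
    levels t that separate x from y, Tonelli turns the Gini mean difference
    into the integral over t of the probability that t separates X from Xt.
    That probability is F t + F t - 2 P (X <= t, Xt <= t) = h1 (F t), so that
    GMD X Xt is the Lebesgue integral of h1 (F t), and likewise for Y with its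
    distribution function G and h2 (lemma [GMD_copula]).

    Two comparisons finish the argument.  From delta1 <= delta2 comes
    h2 <= h1, hence GMD Y Yt is at most the integral of h1 (G t).  To pass from
    G to F, consider the image of the Lebesgue measure under F: it gives an
    interval ]a, b] with 0 < a <= b < 1 the mass Q b - Q a, where Q is the
    quantile function ([lebesgue_rcdf_itv]), even when F has jumps or flat
    parts.  The dispersive order therefore says precisely that the image
    measure of G is below that of F on such intervals.

    This inequality extends to integrals of h1 because h1 is nonnegative,
    vanishes at 0 and at 1, and is Lipschitz, a copula being Lipschitz in each
    variable: h1 is the limit of step functions that stay below it, have
    nonnegative coefficients, and use intervals bounded away from 0 and 1 only
    ([cvg_lower_step]).  The inequality is summed over the steps and passes to
    the limit by Fatou's lemma ([le_integral_comp]).  The endpoints have to be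
    avoided, since the dispersive order compares quantiles of levels in the
    open interval ]0, 1[ only. *)

(** * Diagonal sections of copulas *)

Section DiagonalGap.
Context (R : realType) (C : R -> R -> R) (hC : is_copula C).

(** Both bounds come from rectangles with nonnegative mass: the increment of C
    in one variable is nonnegative (rectangles touching the side where C
    vanishes) and at most the increment of the marginal (rectangles touching
    the opposite side).  Going from (v, v) to (u, u) takes one increment in each
    variable. *)
Lemma diagonal_section_incr (u v : R) : 0 <= v -> v <= u -> u <= 1 ->
  0 <= diagonal_section C u - diagonal_section C v <= 2 * (u - v).
Proof.
case: hC => C0l C0r C1l C1r C2 v0 vu u1; rewrite /diagonal_section.
have u01 : 0 <= u <= 1 by lra.
have v01 : 0 <= v <= 1 by lra.
have := C2 v u v 1 v0 vu u1 v0 ltac:(lra) (lexx 1).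
have := C2 u 1 v u ltac:(lra) u1 (lexx 1) v0 vu u1.
have := C2 0 v v u (lexx 0) v0 ltac:(lra) v0 vu u1.
have := C2 v u 0 u v0 vu u1 (lexx 0) ltac:(lra) u1.
by rewrite !C0l// !C0r// !C1l// !C1r//; lra.
Qed.

(** With u the common value of two distribution functions at t, this is the
    probability that t separates the two variables; the factor 2 accounts for
    the two orders in which they can be separated. *)
Definition diagonal_gap (u : R) : R := 2 * (u - diagonal_section C u).

Lemma diagonal_gap0 : diagonal_gap 0 = 0.
Proof.
by rewrite /diagonal_gap /diagonal_section (copula0l hC) ?lexx ?ler01//; lra.
Qed.

Lemma diagonal_gap1 : diagonal_gap 1 = 0.
Proof.
by rewrite /diagonal_gap /diagonal_section (copula1l hC) ?lexx ?ler01//; lra.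
Qed.

Lemma diagonal_gap_ge0 (u : R) : 0 <= u <= 1 -> 0 <= diagonal_gap u.
Proof.
case: hC => C0l C0r C1l C1r C2 u01.
have := C2 0 u u 1 (lexx 0) ltac:(lra) ltac:(lra) ltac:(lra) ltac:(lra) (lexx 1).
by rewrite C1r// !C0l ?lexx ?ler01// /diagonal_gap /diagonal_section; lra.
Qed.

Lemma diagonal_gap_lipschitz (u v : R) : 0 <= v -> v <= u -> u <= 1 ->
  `|diagonal_gap u - diagonal_gap v| <= 2 * (u - v).
Proof.
move=> v0 vu u1; have := diagonal_section_incr v0 vu u1.
by rewrite ler_norml /diagonal_gap; lra.
Qed.

End DiagonalGap.

(** * Quantiles and level sets of the distribution function *)

Section Quantile.
Context d (T : measurableType d) (R : realType) (P : probability T R).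
Variable X : {RV P >-> R}.
Local Open Scope classical_set_scope.

(** [cdf] takes extended real values, while copulas and quantiles are functions
    of real levels. *)
Definition rcdf (t : R) : R := fine (cdf X t).

Lemma rcdfE t : (rcdf t)%:E = cdf X t.
Proof. by rewrite /rcdf fineK// fin_num_measure. Qed.

Lemma rcdf_nondecreasing : nondecreasing_fun rcdf.
Proof. by move=> s t st; rewrite -lee_fin !rcdfE cdf_nondecreasing. Qed.

Lemma rcdf01 t : 0 <= rcdf t <= 1.
Proof. by rewrite -!lee_fin rcdfE cdf_ge0 cdf_le1. Qed.

Lemma measurable_rcdf : measurable_fun setT rcdf.
Proof. exact: nondecreasing_measurable rcdf_nondecreasing. Qed.

(** The sublevel sets of a nondecreasing function are rays.  Whether this one
    contains its endpoint depends on a possible jump or flat part at level u,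
    but the endpoint does not matter for the Lebesgue measure.  The condition
    0 < u < 1 makes the ray nonempty and proper, so that its supremum is
    meaningful. *)
Lemma rcdf_le_itv u : 0 < u -> u < 1 ->
  `]-oo, quantile X u[ `<=` [set t | rcdf t <= u] /\
  [set t | rcdf t <= u] `<=` `]-oo, quantile X u].
Proof.
move=> u0 u1; rewrite /quantile.
set S := [set x : R | _].
have SE : S = [set t | rcdf t <= u].
  by apply/seteqP; split => t /=; rewrite -lee_fin rcdfE.
have S0 : S !=set0.
  have /fine_cvg/cvgrPdist_le/(_ u u0) := cvg_cdfNy0 X.
  move=> /filter_ex[t] /=; rewrite sub0r normrN => tu; exists t.
  by rewrite SE /=; apply: le_trans tu; rewrite ler_norm.
have [t1 t1u] : exists t, u < rcdf t.
  have /fine_cvg/cvgrPdist_lt/(_ (1 - u)) := cvg_cdfy1 X.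
  move=> /(_ ltac:(lra))/filter_ex[t] /=; rewrite ltr_norml => tu; exists t.
  by rewrite /rcdf; lra.
have Sub : has_ubound S.
  exists t1; rewrite SE => t /= tu; rewrite leNgt; apply/negP => t1t.
  by have := rcdf_nondecreasing (ltW t1t); lra.
rewrite -SE; split => t /=; rewrite in_itv/=; last first.
  by move=> St; exact: ub_le_sup.
move=> /sup_gt[//|s Ss ts]; move: Ss; rewrite SE /=; apply: le_trans.
exact: rcdf_nondecreasing (ltW ts).
Qed.

(** The set lies between the open and the closed interval with endpoints the two
    quantiles, being the difference of two rays.  This is where the dispersive
    order meets integration: quantile spacings are masses of the image of the
    Lebesgue measure under the distribution function. *)
Lemma lebesgue_rcdf_itv a b : 0 < a -> a <= b -> b < 1 ->
  lebesgue_measure [set t | a < rcdf t <= b] = (quantile X b - quantile X a)%:E.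
Proof.
move=> a0 ab b1.
have [la ua] := rcdf_le_itv a0 ltac:(lra).
have [lb ub] := rcdf_le_itv (u := b) ltac:(lra) b1.
have Qab : quantile X a <= quantile X b.
  rewrite leNgt; apply/negP => Qba.
  pose m := (quantile X a + quantile X b) / 2.
  have : rcdf m <= a by apply: la; rewrite /= in_itv/= /m; lra.
  move=> ma; have /ub : rcdf m <= b by lra.
  by rewrite /= in_itv/= /m; lra.
have mS : measurable [set t | a < rcdf t <= b].
  have -> : [set t | a < rcdf t <= b] = rcdf @^-1` `]a, b].
    by apply/seteqP; split => t /=; rewrite in_itv.
  by rewrite -[X in measurable X]setTI; exact: measurable_rcdf.
apply/eqP; rewrite eq_le; apply/andP; split.
  rewrite (@le_trans _ _ (lebesgue_measure `[quantile X a, quantile X b]))//.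
    apply: le_measure; rewrite ?inE//= => t /= /andP[at_ tb]; rewrite in_itv/=.
    have := ub _ tb; rewrite /= in_itv/= => ->; rewrite andbT leNgt.
    apply/negP => tQ; have := la t; rewrite /= in_itv/= => /(_ tQ).
    by lra.
  by rewrite lebesgue_measure_itv/= lte_fin; case: ltP => // ba; rewrite lee_fin; lra.
rewrite (@le_trans _ _ (lebesgue_measure `]quantile X a, quantile X b[))//.
  rewrite lebesgue_measure_itv/= lte_fin; case: ltP => // ba; rewrite lee_fin; lra.
apply: le_measure; rewrite ?inE//= => t /=; rewrite in_itv/= => /andP[at_ tb].
have -> : rcdf t <= b by apply: lb; rewrite /= in_itv.
rewrite andbT ltNge; apply/negP => /ua; rewrite /= in_itv/=; lra.
Qed.

End Quantile.

(** * The Gini mean difference as an integral over separating levels *)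

Section SymmetricDifference.
Context d (T : measurableType d) (R : realType) (P : probability T R).
Local Open Scope classical_set_scope.

Lemma probability_union_minus_inter (A B : set T) :
  measurable A -> measurable B ->
  P ((A `|` B) `\` (A `&` B)) = (P A + P B - P (A `&` B) - P (A `&` B))%E.
Proof.
move=> mA mB; transitivity (P (A `|` B) - P (A `&` B))%E.
  have {2}-> : A `&` B = (A `|` B) `&` (A `&` B).
    by apply/esym/setIidr => w [Aw _]; left.
  apply: measureD; [exact: measurableU|exact: measurableI|].
  by rewrite ltey_eq fin_num_measure//; exact: measurableU.
by rewrite measureUfinr// ltey_eq fin_num_measure.
Qed.

End SymmetricDifference.

Section GiniTonelli.
Context d (T : measurableType d) (R : realType) (P : probability T R).
Variables X Y : {RV P >-> R}.
Local Open Scope classical_set_scope.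

(* The Lebesgue measure lives on this sigma-algebra, which is that of the
   borelian sets but carries another display. *)
Let RB : measurableType _ := measurableTypeR R.

Let between : set (T * RB) :=
  [set z | Num.min (X z.1) (Y z.1) <= z.2 < Num.max (X z.1) (Y z.1)].

Let measurable_between : measurable between.
Proof.
have mX : measurable_fun setT (fun z : T * RB => X z.1).
  by apply: measurableT_comp => //; exact: measurable_fst.
have mY : measurable_fun setT (fun z : T * RB => Y z.1).
  by apply: measurableT_comp => //; exact: measurable_fst.
have m2 : measurable_fun setT (fun z : T * RB => z.2) by exact: measurable_snd.
have : measurable_fun setT (fun z : T * RB =>
    (Num.min (X z.1) (Y z.1) <= z.2) && (z.2 < Num.max (X z.1) (Y z.1))).
  apply: measurable_and.
    by apply: measurable_fun_ler => //; exact: measurable_minr.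
  by apply: measurable_fun_ltr => //; exact: measurable_maxr.
by move=> /(_ measurableT [set true] Logic.I); rewrite setTI.
Qed.

(** Tonelli for the set [between]: its section at an outcome w is an interval of
    length `|X w - Y w|, and its section at a level t is the event that exactly
    one of X <= t and Y <= t holds. *)
Lemma GMD_integral : GMD X Y = (\int[lebesgue_measure]_t
  (rcdf X t + rcdf Y t - 2 * fine (P [set w | X w <= t /\ Y w <= t]))%:E)%E.
Proof.
have := @indic_fubini_tonelli _ _ T RB R P lebesgue_measure _ measurable_between.
rewrite indic_fubini_tonelli_FE// indic_fubini_tonelli_GE// => E.
rewrite /GMD unlock; transitivity (\int[P]_w
    (lebesgue_measure \o xsection between) w)%E.
  apply: eq_integral => w _ /=.
  have -> : xsection between w = `[Num.min (X w) (Y w), Num.max (X w) (Y w)[.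
    by apply/seteqP; split => t; rewrite /xsection /= inE /between/= in_itv.
  rewrite lebesgue_measure_itv/= lte_fin.
  have [XY|XY|<-] := ltgtP (X w) (Y w); rewrite ?ltxx.
  - by rewrite XY distrC gtr0_norm ?subr_gt0.
  - by rewrite XY gtr0_norm ?subr_gt0.
  - by rewrite subrr normr0.
rewrite E; apply: eq_integral => t _ /=.
set A := [set w | X w <= t]; set B := [set w | Y w <= t].
have mA : measurable A.
  have -> : A = X @^-1` `]-oo, t] by apply/seteqP; split => w /=; rewrite in_itv.
  by rewrite -[X in measurable X]setTI; exact: measurable_funP.
have mB : measurable B.
  have -> : B = Y @^-1` `]-oo, t] by apply/seteqP; split => w /=; rewrite in_itv.
  by rewrite -[X in measurable X]setTI; exact: measurable_funP.
have mAB : measurable (A `&` B) by exact: measurableI.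
have -> : ysection between t = (A `|` B) `\` (A `&` B).
  apply/seteqP; split => w; rewrite /ysection /= inE /between/=.
    rewrite ge_min lt_max => /andP[/orP H1 /orP H2]; split => //.
    by move=> [? ?]; case: H2; rewrite ltNge => /negP.
  move=> [H1 H2]; rewrite ge_min lt_max; apply/andP; split; first exact/orP.
  by rewrite !ltNge -(negb_and); apply/negP => /andP.
have cX : (rcdf X t)%:E = P A.
  by rewrite rcdfE /cdf /distribution /pushforward; congr (P _);
    apply/seteqP; split => w /=; rewrite in_itv.
have cY : (rcdf Y t)%:E = P B.
  by rewrite rcdfE /cdf /distribution /pushforward; congr (P _);
    apply/seteqP; split => w /=; rewrite in_itv.
rewrite probability_union_minus_inter// -cX -cY.
have : P (A `&` B) \is a fin_num by rewrite fin_num_measure.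
rewrite -[X in fine (P X)]/(A `&` B).
case: (P (A `&` B)) => //= p _.
by rewrite -!EFinD; congr EFin; lra.
Qed.

End GiniTonelli.

(** * Integrals of Lipschitz functions vanishing at 0 and 1 *)

Section StepApproximation.
Context (R : realType) (h : R -> R) (L : R).
Hypotheses (h0 : h 0 = 0) (h1 : h 1 = 0).
Hypothesis h_ge0 : forall u : R, 0 <= u <= 1 -> 0 <= h u.
Hypothesis h_lip : forall u v : R, 0 <= v -> v <= u -> u <= 1 ->
  `|h u - h v| <= L * (u - v).
Local Open Scope classical_set_scope.

(** The points m / (n + 2) subdivide [0, 1].  The first and the last cell of the
    subdivision, of index 0 and n + 1, are left out of the step functions, so
    that n cells remain, all bounded away from 0 and 1. *)
Definition grid (n m : nat) : R := m%:R / n.+2%:R.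

Lemma grid_le n m1 m2 : (m1 <= m2)%N -> grid n m1 <= grid n m2.
Proof. by move=> ?; rewrite ler_pM2r ?invr_gt0 ?ler_nat. Qed.

Lemma gridS n m : grid n m.+1 = grid n m + n.+2%:R^-1.
Proof. by rewrite /grid -natr1 mulrDl mul1r. Qed.

Lemma grid0 n : grid n 0 = 0. Proof. by rewrite /grid mul0r. Qed.

Lemma grid1 n : grid n n.+2 = 1. Proof. by rewrite /grid divff. Qed.

Definition cell n m : set R := `]grid n m, grid n m.+1].

Lemma measurable_cell n m : measurable (cell n m).
Proof. exact: measurable_itv. Qed.

(** By the Lipschitz bound, h is at least [h (grid n m) - L / n.+2%:R] on the
    whole cell; the maximum with 0 makes the step function nonnegative, and it
    is still below h because h is nonnegative. *)
Definition cell_value n m : R := Num.max 0 (h (grid n m) - L / n.+2%:R).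

Definition lower_step n u : R :=
  \sum_(k < n) cell_value n k.+1 * \1_(cell n k.+1) u.

Lemma cell_value_ge0 n m : 0 <= cell_value n m.
Proof. by rewrite le_max lexx. Qed.

Lemma cell_inj n m1 m2 u : cell n m1 u -> cell n m2 u -> m1 = m2.
Proof.
suff le m m' : cell n m u -> cell n m' u -> (m <= m')%N.
  by move=> u1 u2; apply/eqP; rewrite eqn_leq !le.
rewrite /cell/= !in_itv/= => /andP[mu _] /andP[_ um'].
rewrite leqNgt; apply/negP => mm'.
have := grid_le n mm'; lra.
Qed.

Lemma cell_exists n u : 0 < u <= 1 -> exists2 m, (m <= n.+1)%N & cell n m u.
Proof.
move=> /andP[u0 u1].
have ex : exists m, u <= grid n m by exists n.+2; rewrite grid1.
have [[|m] um mmin] := ex_minnP ex; first by move: um; rewrite grid0; lra.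
exists m; first by rewrite -ltnS; apply: mmin; rewrite grid1.
rewrite /cell/= in_itv/= um andbT ltNge; apply/negP => /mmin.
by rewrite ltnn.
Qed.

Lemma lower_step_in n k u : (k < n)%N -> cell n k.+1 u ->
  lower_step n u = cell_value n k.+1.
Proof.
move=> kn uk; rewrite /lower_step (bigD1 (Ordinal kn))//= indicE mem_set// mulr1.
rewrite big1 ?addr0// => j /eqP jk; rewrite indicE memNset ?mulr0// => uj.
by apply: jk; apply/val_inj; have [] := cell_inj uj uk.
Qed.

Lemma lower_step_out n u : (forall k, (k < n)%N -> ~ cell n k.+1 u) ->
  lower_step n u = 0.
Proof.
move=> uk; rewrite /lower_step big1// => k _.
by rewrite indicE memNset ?mulr0//; exact: uk.
Qed.

(** Over one cell h varies by at most [L / n.+2%:R], and the value of the step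
    loses this amount once more.  In the two cells left out the step function is
    0, and h is at most [L / n.+2%:R] since it vanishes at 0 and 1. *)
Lemma lower_step_bounds n (u : R) : 0 <= u <= 1 ->
  h u - 2 * L / n.+2%:R <= lower_step n u <= h u.
Proof.
move=> u01; have h_u := h_ge0 u01.
have L0 : 0 <= L.
  by have := h_lip (lexx 0) ler01 (lexx 1); rewrite h0 h1 subrr normr0; lra.
have valE m : cell_value n m = Num.max 0 (h (grid n m) - L / n.+2%:R) by [].
(* Abstracting the mesh of the grid leaves linear arithmetic in [L * e]. *)
have : 0 < n.+2%:R^-1 :> R by rewrite invr_gt0.
move: (n.+2%:R^-1) valE (gridS n) => e valE gS e0.
have Le0 : 0 <= L * e by rewrite mulr_ge0// ltW.
have out : h u <= 2 * L * e -> (forall k, (k < n)%N -> ~ cell n k.+1 u) ->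
    h u - 2 * L * e <= lower_step n u <= h u.
  by move=> hu uk; rewrite lower_step_out//; lra.
have [u0|u0] := eqVneq u 0.
  apply: out => [|k kn]; first by rewrite u0 h0; lra.
  rewrite /cell/= in_itv/= u0 => /andP[+ _]; apply/negP; rewrite -leNgt.
  by rewrite -(grid0 n) grid_le.
have [m mn mu] : exists2 m, (m <= n.+1)%N & cell n m u.
  by apply: cell_exists; rewrite lt_neqAle eq_sym u0.
have := mu; rewrite /cell/= in_itv/= gS => /andP[gu ug].
have g0 : 0 <= grid n m by rewrite -(grid0 n) grid_le.
have lip (v w : R) : 0 <= v -> v <= w -> w <= 1 -> w - v <= e ->
    `|h w - h v| <= L * e.
  move=> v0 vw w1 wv; apply: le_trans (h_lip v0 vw w1) _.
  by rewrite ler_wpM2l.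
case: m => [|m] in mn mu gu ug g0 *.
  apply: out => [|k kn uk]; last by have := cell_inj mu uk.
  move: ug; rewrite grid0 => ug.
  have := lip 0 u (lexx 0) ltac:(lra) ltac:(lra) ltac:(lra).
  by rewrite h0 ler_norml; lra.
have [mn'|mn'] := ltnP m n.
  rewrite (lower_step_in mn' mu).
  have := lip (grid n m.+1) u g0 (ltW gu) ltac:(lra) ltac:(lra).
  rewrite ler_norml valE => /andP[l1 l2].
  by rewrite le_max ge_max; apply/andP; split; [apply/orP; right|]; lra.
have mE : m = n by apply/eqP; rewrite eqn_leq mn' -ltnS mn.
apply: out => [|k kn uk]; last first.
  by have [mk] := cell_inj mu uk; move: kn; rewrite -mk mE ltnn.
have := grid1 n; rewrite gS => gn; rewrite mE in gu.
have := lip u 1 ltac:(lra) ltac:(lra) (lexx 1) ltac:(lra).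
by rewrite h1 ler_norml; lra.
Qed.

Lemma cvg_lower_step (u : R) : 0 <= u <= 1 -> lower_step n u @[n --> \oo] --> h u.
Proof.
move=> u01; apply: (@squeeze_cvgr _ _ _ _ (fun n => h u - 2 * L / n.+2%:R)
  (fun=> h u)).
- by near=> n; exact: lower_step_bounds.
- rewrite -[X in _ --> X]subr0; apply: cvgB; first exact: cvg_cst.
  rewrite -[X in _ --> X](mulr0 (2 * L)); apply: cvgM; first exact: cvg_cst.
  have := @cvg_harmonic R; rewrite -(cvg_shiftS (@harmonic R)).
  exact.
- exact: cvg_cst.
Unshelve. all: by end_near. Qed.

Context d (T : measurableType d) (mu : {measure set T -> \bar R}).

Lemma measurable_lower_step (f : T -> R) n : measurable_fun setT f ->
  measurable_fun setT (fun t => lower_step n (f t)).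
Proof.
move=> mf; apply: measurable_sum => k.
apply: measurable_funM => //.
by apply: (measurableT_comp _ mf); apply: measurable_indic (measurable_cell _ _).
Qed.

Lemma measurable_lipschitz_comp (f : T -> R) : measurable_fun setT f ->
  (forall t, 0 <= f t <= 1) -> measurable_fun setT (fun t => (h (f t))%:E).
Proof.
move=> mf f01; apply: (@emeasurable_fun_cvg _ _ _ _
  (fun n t => (lower_step n (f t))%:E)) => //.
  by move=> n; apply/measurable_EFinP; exact: measurable_lower_step.
by move=> t _; apply: cvg_EFin; [exact: nearW|exact: cvg_lower_step].
Qed.

Lemma integral_lower_step (f : T -> R) n : measurable_fun setT f ->
  (\int[mu]_t (lower_step n (f t))%:E = \sum_(k < n)
    (cell_value n k.+1)%:E * mu [set t | (grid n k.+1 < f t <= grid n k.+2)%R])%E.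
Proof.
move=> mf.
under eq_integral do rewrite /lower_step -sumEFin.
have mI k : measurable_fun setT (fun t => (\1_(cell n k.+1) (f t))%:E : \bar R).
  apply/measurable_EFinP; apply: (measurableT_comp _ mf).
  exact: measurable_indic (measurable_cell _ _).
rewrite ge0_integral_sum//; first last.
- by move=> k t _; rewrite lee_fin mulr_ge0 ?cell_value_ge0.
- by move=> k; under eq_fun do rewrite EFinM; exact: measurable_funeM.
apply: eq_bigr => k _; under eq_integral do rewrite EFinM.
rewrite ge0_integralZl//; last by rewrite lee_fin cell_value_ge0.
congr (_ * _)%E.
have mS : measurable (f @^-1` (cell n k.+1)).
  by rewrite -[X in measurable X]setTI; exact: mf (measurable_cell _ _).
rewrite -[LHS]/(\int[mu]_t (\1_(f @^-1` (cell n k.+1)) t)%:E)%E.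
rewrite integral_indic// setIT; congr (mu _).
Qed.

(** Comparing the image measures on intervals bounded away from 0 and 1 is
    enough to compare the integrals of h: the inequality holds for the step
    functions below h by linearity, and Fatou's lemma carries it to the limit. *)
Lemma le_integral_comp (f g : T -> R) :
  measurable_fun setT f -> measurable_fun setT g ->
  (forall t, 0 <= f t <= 1) -> (forall t, 0 <= g t <= 1) ->
  (forall a b, 0 < a -> a <= b -> b < 1 ->
    (mu [set t | (a < f t <= b)%R] <= mu [set t | (a < g t <= b)%R])%E) ->
  (\int[mu]_t (h (f t))%:E <= \int[mu]_t (h (g t))%:E)%E.
Proof.
move=> mf mg f01 g01 fg.
have step_ge0 n u : (0 <= (lower_step n u)%:E)%E.
  by rewrite lee_fin sumr_ge0// => k _; rewrite mulr_ge0 ?cell_value_ge0.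
have mstep (k : T -> R) n : measurable_fun setT k ->
    measurable_fun setT (fun t => (lower_step n (k t))%:E).
  by move=> mk; apply/measurable_EFinP; exact: measurable_lower_step.
have le_step n : (\int[mu]_t (lower_step n (f t))%:E <=
    \int[mu]_t (h (g t))%:E)%E.
  apply: (@le_trans _ _ (\int[mu]_t (lower_step n (g t))%:E)%E).
    rewrite !integral_lower_step//; apply: lee_sum => k _.
    apply: lee_wpmul2l; first by rewrite lee_fin cell_value_ge0.
    apply: fg.
    - by rewrite divr_gt0.
    - exact: grid_le.
    - by rewrite -(grid1 n) ltr_pM2r ?invr_gt0// ltr_nat !ltnS.
  apply: ge0_le_integral => //; [exact: mstep|exact: measurable_lipschitz_comp|].
  by move=> t _; rewrite lee_fin; have /andP[] := lower_step_bounds n (g01 t).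
have -> : (\int[mu]_t (h (f t))%:E =
    \int[mu]_t limn_einf (fun n => (lower_step n (f t))%:E))%E.
  apply: eq_integral => t _; apply/esym.
  have cv : (lower_step n (f t))%:E @[n --> \oo] --> (h (f t))%:E.
    by apply: cvg_EFin; [exact: nearW|exact: cvg_lower_step].
  by have [-> _] := cvg_limn_einf_sup cv.
apply: (le_trans (fatou mu measurableT (fun n => mstep f n mf) _)) => //.
rewrite limn_einf_lim; apply: lime_le; first exact: is_cvg_einfs.
apply: nearW => n; apply: le_trans (le_step n).
by apply: ereal_inf_lbound; exists n => /=.
Qed.

End StepApproximation.

(** * The comparison of Gini mean differences *)

(** As the two laws agree, both arguments of the copula are the same level, so
    only its diagonal section enters. *)
Lemma GMD_copula d (T : measurableType d) (R : realType) (P : probability T R)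
    (X Xt : {RV P >-> R}) (C : R -> R -> R) :
  has_copula X Xt C -> eq_law X Xt ->
  GMD X Xt = (\int[lebesgue_measure]_t (diagonal_gap C (rcdf X t))%:E)%E.
Proof.
move=> [_ hC] hlaw; rewrite GMD_integral; apply: eq_integral => t _.
have XtX : rcdf Xt t = rcdf X t by rewrite /rcdf /cdf hlaw.
rewrite hC /= -/(rcdf X t) -/(rcdf Xt t) XtX /diagonal_gap /diagonal_section.
by congr EFin; lra.
Qed.

Theorem theorem3p3 (R : realType)
    (d1 : measure_display) (T1 : measurableType d1) (P1 : probability T1 R)
    (d2 : measure_display) (T2 : measurableType d2) (P2 : probability T2 R)
    (X Xt : {RV P1 >-> R}) (Y Yt : {RV P2 >-> R})
    (C1 C2 : R -> R -> R)
    (hX : nonneg_finite_mean X) (hXt : nonneg_finite_mean Xt)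
    (hY : nonneg_finite_mean Y) (hYt : nonneg_finite_mean Yt)
    (hC1 : has_copula X Xt C1) (hC2 : has_copula Y Yt C2)
    (hlawX : eq_law X Xt) (hlawY : eq_law Y Yt)
    (hdisp : dispersive_le Y X)
    (hdiag : le01 (diagonal_section C1) (diagonal_section C2)) :
  (GMD X Xt >= GMD Y Yt)%E.
Proof.
rewrite (GMD_copula hC1 hlawX) (GMD_copula hC2 hlawY).
have [cC1 _] := hC1; have [cC2 _] := hC2.
have mgap C : is_copula C -> measurable_fun setT
    (fun t => (diagonal_gap C (rcdf Y t))%:E).
  move=> hC; apply: (measurable_lipschitz_comp (diagonal_gap0 hC)
    (diagonal_gap1 hC) (diagonal_gap_ge0 hC) (diagonal_gap_lipschitz hC)).
    exact: measurable_rcdf.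
  exact: rcdf01.
apply: (@le_trans _ _
  (\int[lebesgue_measure]_t (diagonal_gap C1 (rcdf Y t))%:E)%E).
  apply: ge0_le_integral => //; [|exact: mgap|exact: mgap|].
  - by move=> t _; rewrite lee_fin (diagonal_gap_ge0 cC2)// rcdf01.
  - move=> t _; rewrite lee_fin; have := hdiag _ (rcdf01 Y t).
    by rewrite /diagonal_gap; lra.
apply: (le_integral_comp (diagonal_gap0 cC1) (diagonal_gap1 cC1)
  (diagonal_gap_ge0 cC1) (diagonal_gap_lipschitz cC1)).
- exact: measurable_rcdf.
- exact: measurable_rcdf.
- exact: rcdf01.
- exact: rcdf01.
- move=> a b a0 ab b1; have := hdisp a b a0 ab b1.
  by rewrite -lee_fin -!lebesgue_rcdf_itv.
Qed.
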